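(* Let $P=\prod_{j=1}^m\Delta^{n_j}$ be a finite product of simplices, $n=\sum_{j=1}^m n_j$, and let $M^n(P,\lambda)$ be the small cover over $P$ with characteristic function $\lambda$ normalized so that $\lambda(F_1^j),\dots,\lambda(F_{n_j}^j)$, $j=1,\dots,m$, are the standard basis vectors of $\mathbb{Z}_2^n$ as described in the context. Let $y_j$ be the degree-one class corresponding to the facet $F_0^j$ in the presentation $H^*(M^n(P,\lambda);\mathbb{Z}_2)\cong\mathbb{Z}_2[y_1,\dots,y_m]/I$ described in the context. Then for every $j\in\{1,\dots,m\}$, $y_j^{n_j}\neq 0$ in $H^*(M^n(P,\lambda);\mathbb{Z}_2)$.
   Context: Small covers: an $n$-dimensional convex polytope $P$ is simple if exactly $n$ facets meet at each vertex; $\mathcal{F}(P)$ denotes its set of facets. A characteristic function is a map $\lambda\colon \mathcal{F}(P)\to\mathbb{Z}_2^n$ such that whenever distinct facets $F_{i_1},\dots,F_{i_\ell}$ satisfy $F_{i_1}\cap\cdots\cap F_{i_\ell}\neq\emptyset$, the vectors $\lambda(F_{i_1}),\dots,\lambda(F_{i_\ell})$ generate an $\ell$-dimensional direct summand of $\mathbb{Z}_2^n$. For $p\in P$ let $F(p)=F_{i_1}\cap\cdots\cap F_{i_k}$ be the unique face containing $p$ in its relative interior, and let $G_{F(p)}\subseteq\mathbb{Z}_2^n$ be the subgroup generated by $\lambda(F_{i_1}),\dots,\lambda(F_{i_k})$. The small cover is $M^n(P,\lambda)=(P\times\mathbb{Z}_2^n)/\sim$, where $(p,g)\sim(q,h)$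 iff $p=q$ and $g^{-1}h\in G_{F(p)}$. By Davis--Januszkiewicz, $H^*(M^n(P,\lambda);\mathbb{Z}_2)\cong\mathbb{Z}_2[v_1,\dots,v_r]/(\tilde I+\tilde J)$, with one degree-one generator $v_i$ per facet $F_i$, $\tilde I$ generated by the monomials $v_{s_1}\cdots v_{s_\ell}$ with $F_{s_1}\cap\cdots\cap F_{s_\ell}=\emptyset$, and $\tilde J$ generated by the $n$ coordinates of $\sum_i\lambda(F_i)v_i$. Product of simplices: let $F_0^{\Delta_j},\dots,F_{n_j}^{\Delta_j}$ be the facets of $\Delta^{n_j}$. The facets of $P=\prod_j\Delta^{n_j}$ are $F_k^j=\Delta^{n_1}\times\cdots\times F_k^{\Delta_j}\times\cdots\times\Delta^{n_m}$, $0\le k\le n_j$, $1\le j\le m$. Put $\mathcal{N}_j=n_1+\cdots+n_j$, $\mathcal{N}_0=0$. Since $\bigcap_{j}\bigcap_{k\ge1}F_k^j$ is a vertex, one may and does assume $\lambda(F_k^j)=e_{\mathcal{N}_{j-1}+k}$ for $1\le k\le n_j$. Write $\lambda(F_0^\ell)=\boldsymbol{\alpha_\ell}\in\mathbb{Z}_2^n$ and let $\alpha^j_{\ell k}\in\mathbb{Z}_2$ be its coordinate in position $\mathcal{N}_{j-1}+k$ ($1\le k\le n_j$). Let $y_j$ be the generator corresponding to $F_0^j$. Eliminating the generators of the other facets via $\tilde J$ gives $H^*(M^n(P,\lambda);\mathbb{Z}_2)\cong\mathbb{Z}_2[y_1,\dots,y_m]/I$, where $I$ is generated by the elements $\Big(\prod_{k=1}^{n_j}\sum_{\ell=1}^m\alpha^j_{\ell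 k}y_\ell\Big)y_j$ for $j=1,\dots,m$. *)

(* Defs.v *)
From HB Require Import structures.
From mathcomp Require Import all_boot all_order all_algebra.
From mathcomp Require Import all_classical all_reals topology normedtype.
From mathcomp Require Import -(notations) mpoly.

Set Implicit Arguments.
Unset Strict Implicit.
Unset Printing Implicit Defensive.

Import Order.TTheory GRing.Theory Num.Theory.
Import numFieldNormedType.Exports.
Local Open Scope classical_set_scope.
Local Open Scope quotient_scope.
Local Open Scope ring_scope.

Lemma continuous_to_initial (Z : topologicalType) (S : choiceType)
    (T : topologicalType) (f : S -> T) (g : Z -> initial_topology f) :
  continuous (f \o g) -> continuous g.
Proof.
move=> /continuousP fgc; apply/continuousP => A [B oB <-].
by rewrite -comp_preimage; exact: fgc.
Qed.

Lemma continuous_to_ptws (Z T : topologicalType) (I : Type)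
    (g : Z -> {ptws I -> T}) :
  (forall i, continuous (fun z => g z i)) -> continuous g.
Proof.
move=> gc z; apply/cvg_sup => i.
by apply: (@continuous_to_initial Z _ _ _ (g : Z -> initial_topology _)); exact: gc.
Qed.

(* The simplex with vertex set I, in barycentric coordinates. *)
Definition std_simplex (R : realType) (I : finType) : set {ptws I -> R} :=
  [set x | (forall i, 0 <= x i) /\ \sum_i x i = 1].

Section SingularCohomology.
Variables (R : realType) (X : topologicalType).

Definition Delta (d : nat) : topologicalType :=
  set_type (@std_simplex R 'I_d.+1).

Section AffineMap.
Variables (p q : nat) (f : nat -> nat).

Definition affine_fun (x : {ptws 'I_p.+1 -> R}) : {ptws 'I_q.+1 -> R} :=
  fun j => \sum_(l < p.+1 | inord (f l) == j) x l.

Lemma affine_fun_simplex (x : Delta p) :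
  affine_fun (set_val x) \in @std_simplex R 'I_q.+1.
Proof.
have [x0 x1] := set_mem (valP x); apply/mem_set; split.
  by move=> i; apply: sumr_ge0 => l _; exact: x0.
rewrite -x1 /affine_fun.
by rewrite [RHS](partition_big (fun l : 'I_p.+1 => inord (f l) : 'I_q.+1) xpredT).
Qed.

(* The affine map of standard simplices sending the vertex l of the source to
   the vertex f l of the target; it is used only when f l <= q for l <= p. *)
Definition affine_map (x : Delta p) : Delta q :=
  exist _ (affine_fun (set_val x)) (affine_fun_simplex x).

Lemma affine_map_continuous : continuous affine_map.
Proof.
apply: (@continuous_to_initial _ _ _ set_val
  (affine_map : _ -> initial_topology (@set_val _ _))).
apply: continuous_to_ptws => j.
rewrite (_ : (fun z => _) = (fun z : Delta p =>
  \sum_(l < p.+1 | inord (f l) == j) (set_val z : {ptws _ -> R}) l)) //.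
apply: continuous_big => [|l _]; first exact: add_continuous.
move=> z; apply: (@continuous_comp _ _ _ (set_val : Delta p -> _)
  (fun x : {ptws 'I_p.+1 -> R} => x l)).
  exact: initial_continuous.
exact: (@proj_continuous 'I_p.+1 (fun=> R) l).
Qed.

HB.instance Definition _ :=
  isContinuous.Build (Delta p) (Delta q) affine_map affine_map_continuous.
End AffineMap.

Lemma affine_map_comp p q r f g (x : Delta r) :
  (forall l, l <= r -> g l <= p)%N ->
  affine_map q f (affine_map p g x) = affine_map q (f \o g) x.
Proof.
move=> gp; apply/val_inj/funext => j /=; rewrite /affine_fun /=.
rewrite [RHS](partition_big (fun l : 'I_r.+1 => inord (g l) : 'I_p.+1)
  (fun k => inord (f k) == j)) /=; last first.
  by move=> l; rewrite inordK // ltnS gp // -ltnS.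
apply: eq_bigr => k kj; apply: eq_bigl => l.
have [kE|] := eqVneq (inord (g l)) k; rewrite ?andbF // andbT.
by rewrite -[LHS]kj -kE inordK // ltnS gp // -ltnS.
Qed.

Definition singular (d : nat) := continuousType (Delta d) X.

(* s restricted along the affine map sending the vertex l to the vertex f l. *)
Definition pull d (s : singular d) p (f : nat -> nat) : singular p :=
  (s \o affine_map d f : continuousType (Delta p) X).

Lemma pull_pull d (s : singular d) p r f g :
  (forall l, l <= r -> g l <= p)%N ->
  pull (pull s p f) r g = pull s r (f \o g).
Proof.
by move=> gp; apply/continuousEP => x /=; rewrite affine_map_comp.
Qed.

Lemma pull_ext d (s : singular d) p f g :
  (forall l, l <= p -> f l = g l)%N -> pull s p f = pull s p g.
Proof.
move=> fg; apply/continuousEP => x /=; congr (s _).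
apply/val_inj/funext => j /=; apply: eq_bigl => l.
by rewrite fg // -ltnS.
Qed.

Lemma pull_id d (s : singular d) f :
  (forall l, l <= d -> f l = l)%N -> pull s d f = s.
Proof.
move=> fg; apply/continuousEP => x /=; congr (s _).
apply/val_inj/funext => j /=; rewrite /affine_fun (big_pred1 j) //.
by move=> l; rewrite /= fg ?inord_val // -ltnS.
Qed.

Definition simplices := {d : nat & singular d}.

(* The restriction of s to the face with vertices u, u + 1, ..., v. *)
Definition segment d (s : singular d) (u v : nat) : simplices :=
  Tagged singular (pull s (v - u) (addn u)).

(* The restriction of s to the face opposite to the vertex i. *)
Definition face d (s : singular d.+1) (i : nat) : simplices :=
  Tagged singular (pull s d (bump i)).

Definition cochain := simplices -> 'F_2.
HB.instance Definition _ := GRing.Zmodule.on cochain.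

(* Signs are omitted, the coefficients being those of 'F_2. *)
Definition cobound (a : cochain) : cochain := fun s =>
  match s with
  | existT 0 _ => 0
  | existT d.+1 s => \sum_(i < d.+2) a (face s i)
  end.

Definition cup (a b : cochain) : cochain := fun s =>
  \sum_(i < (tag s).+1) a (segment (tagged s) 0 i) * b (segment (tagged s) i (tag s)).

Definition cochain1 : cochain := fun s => (tag s == 0)%:R.

Section Eval.
Variables (d : nat) (s : singular d).

Definition cell p f : simplices := Tagged singular (pull s p f).

Lemma cell_ext p p' f g : p = p' -> (forall l, l <= p -> f l = g l)%N ->
  cell p f = cell p' g.
Proof. by move=> <- fg; rewrite /cell (pull_ext _ fg). Qed.

Lemma segment_cell p f u v : (u <= v <= p)%N ->
  segment (pull s p f) u v = cell (v - u) (f \o addn u).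
Proof.
move=> /andP[uv vp]; rewrite /segment pull_pull // => l lvu.
by rewrite (leq_trans _ vp) // -(subnKC uv) leq_add2l.
Qed.

Lemma segment_segment p q u v : (u <= v <= q - p)%N ->
  segment (pull s (q - p) (addn p)) u v = segment s (p + u) (p + v).
Proof.
move=> uv; rewrite segment_cell //; apply: cell_ext => [|l _] /=.
  by rewrite subnDl.
by rewrite addnA.
Qed.

Lemma face_cell p f i : face (pull s p.+1 f) i = cell p (f \o bump i).
Proof.
rewrite /face pull_pull // => l lp; rewrite /bump -add1n leq_add //.
exact: leq_b1.
Qed.
End Eval.

Lemma cup_segment d (s : singular d) a b u v : (u <= v)%N ->
  cup a b (segment s u v) = \sum_(u <= i < v.+1) a (segment s u i) * b (segment s i v).
Proof.
move=> uv; have := big_addn 0 v.+1 u xpredT (fun i => a (segment s u i) * b (segment s i v)).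
rewrite add0n => ->; rewrite subSn // big_mkord /cup /=.
apply: eq_bigr => -[i /= lti] _; rewrite !segment_segment ?leqnn ?andbT //.
by rewrite addn0 subnKC // (addnC u).
Qed.

Lemma cupE d (s : singular d) a b :
  cup a b (Tagged singular s) =
  \sum_(0 <= i < d.+1) a (segment s 0 i) * b (segment s i d).
Proof. by rewrite big_mkord. Qed.

Lemma cupA : associative cup.
Proof.
move=> a b c; apply/funext => -[d s]; rewrite -/(Tagged singular s) !cupE.
rewrite [RHS](eq_big_nat _ _ (F2 := fun i => \sum_(0 <= k < d.+1 | (k <= i)%N)
  a (segment s 0 k) * b (segment s k i) * c (segment s i d))); last first.
  move=> i /= ltid; rewrite cup_segment // big_distrl /= [RHS]big_mkcond.
  by rewrite [LHS](big_nat_widen _ _ d.+1) // -big_mkcond.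
rewrite (exchange_big_dep_nat xpredT) //=; apply: eq_big_nat => k ltkd.
rewrite cup_segment; last by rewrite -ltnS.
rewrite big_distrr /= (big_nat_widenl _ 0) //.
by apply: eq_bigr => i _; rewrite mulrA.
Qed.

Lemma segment_full d (s : singular d) : segment s 0 d = Tagged singular s.
Proof.
have -> : segment s 0 d = cell s d id by apply: cell_ext; rewrite ?subn0.
by rewrite /cell pull_id.
Qed.

Lemma cup1c : left_id cochain1 cup.
Proof.
move=> a; apply/funext => -[d s]; rewrite -/(Tagged singular s) cupE.
rewrite big_ltn // big_nat big1 ?addr0.
  by rewrite /cochain1 mul1r segment_full.
by case=> // i _; rewrite /cochain1 /= mul0r.
Qed.

Lemma cupc1 : right_id cochain1 cup.
Proof.
move=> a; apply/funext => -[d s]; rewrite -/(Tagged singular s) cupE.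
rewrite big_nat_recr //= big_nat big1 ?add0r.
  by rewrite /cochain1 /= subnn eqxx mulr1 segment_full.
move=> i /andP[_ ltid]; rewrite /cochain1 /= subn_eq0 leqNgt ltid.
by rewrite mulr0.
Qed.

Lemma cupDl : left_distributive cup +%R.
Proof.
move=> a b c; apply/funext => s; apply: etrans (big_split _ _ _ _ _).
by apply: eq_bigr => i _; exact: mulrDl.
Qed.

Lemma cupDr : right_distributive cup +%R.
Proof.
move=> a b c; apply/funext => s; apply: etrans (big_split _ _ _ _ _).
by apply: eq_bigr => i _; exact: mulrDr.
Qed.

HB.instance Definition _ :=
  GRing.Zmodule_isPzRing.Build cochain cupA cup1c cupc1 cupDl cupDr.

Lemma coboundD : {morph cobound : a b / a + b}.
Proof.
move=> a b; apply/funext => -[[|d] s] /=; first exact/esym/addr0.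
by apply: etrans (big_split _ _ _ _ _).
Qed.

Lemma coboundN : {morph cobound : a / - a}.
Proof.
move=> a; apply/funext => -[[|d] s] /=; first exact/esym/oppr0.
by apply: etrans (sumrN _ _ _).
Qed.


Definition gap d (s : singular d) i u v : simplices :=
  cell s (v - u).-1 (fun l => bump i (u + l)).

Lemma cobound_segment d (s : singular d) a u v : (u < v)%N ->
  cobound a (segment s u v) = \sum_(u <= i < v.+1) a (gap s i u v).
Proof.
move=> uv; have [p vE] : exists p, v = (u + p.+1)%N.
  by exists (v - u.+1)%N; rewrite addnS -addSn subnKC.
have -> : segment s u v = cell s p.+1 (addn u) by apply: cell_ext; rewrite ?vE ?addKn.
have := big_addn 0 v.+1 u xpredT (fun i => a (gap s i u v)).
rewrite add0n => ->; rewrite vE -addnS addKn big_mkord /=.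
apply: eq_bigr => i _; rewrite face_cell; congr (a _).
apply: cell_ext => [|l _] /=; first by rewrite addKn.
by rewrite /bump [(i + u)%N]addnC leq_add2l addnCA.
Qed.

Arguments cobound a s : simpl never.

Lemma segment_face d (s : singular d.+1) i u v : (u <= v <= d)%N ->
  segment (pull s d (bump i)) u v = cell s (v - u) (fun l => bump i (u + l)).
Proof. exact: segment_cell. Qed.

Lemma F2_addrr (x : 'F_2) : x + x = 0.
Proof. by rewrite -mulr2n -mulr_natr (_ : 2%:R = 0) ?mulr0 //; apply/val_inj. Qed.

Lemma cobound_cup a b : cobound (cup a b) = cup (cobound a) b + cup a (cobound b).
Proof.
apply/funext => -[[|d] s].
  apply/esym; transitivity (cup (cobound a) b (Tagged singular s)
    + cup a (cobound b) (Tagged singular s)); first by [].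
  by rewrite /cup !big_ord1 /cobound /= mul0r mulr0 addr0.
pose A k := a (segment s 0 k); pose B k := b (segment s k d.+1).
pose A' i k := a (gap s i 0 k); pose B' i k := b (gap s i k d.+1).
pose S1 := \sum_(0 <= k < d.+1) (\sum_(0 <= i < k.+1) A' i k.+1) * B k.+1.
pose S2 := \sum_(0 <= k < d.+1) A k * (\sum_(k.+1 <= i < d.+2) B' i k).
pose T := \sum_(0 <= k < d.+1) A k * B k.+1.
have E1 : cup (cobound a) b (Tagged singular s) = S1 + T.
  rewrite cupE big_nat_recl // mul0r add0r -big_split /=.
  apply: eq_big_nat => k /= kd; rewrite cobound_segment // big_nat_recr //= mulrDl.
  congr (_ + _ * _); congr (a _); apply: cell_ext; rewrite ?subn0 // => l lk.
  by rewrite /bump /= leqNgt ltnS lk add0n.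
have E2 : cup a (cobound b) (Tagged singular s) = T + S2.
  rewrite cupE big_nat_recr //= -big_split /=.
  rewrite [X in _ + _ * X](_ : _ = 0); last first.
    rewrite (_ : segment s d.+1 d.+1 = cell s 0 (addn d.+1)) //.
    by apply: cell_ext; rewrite ?subnn.
  rewrite mulr0 addr0; apply: eq_big_nat => k /= kd.
  rewrite cobound_segment // [X in a _ * X]big_ltn ?mulrDr; last exact: ltnW.
  congr (_ * _ + _); congr (b _); apply: cell_ext; rewrite ?subSS ?subSn // => l _.
  by rewrite /bump leq_addr.
rewrite -/(Tagged singular s).
apply: etrans (_ : S1 + S2 = _); last first.
  transitivity (cup (cobound a) b (Tagged singular s)
    + cup a (cobound b) (Tagged singular s)); last by [].
  by rewrite E1 E2 addrA -(addrA S1) F2_addrr addr0.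
rewrite -[LHS]/(\sum_(i < d.+2) cup a b (face s i)).
rewrite -(big_mkord xpredT (fun i => cup a b (face s i))).
transitivity (\sum_(0 <= i < d.+2) \sum_(0 <= k < d.+1)
   ((if (i <= k)%N then A' i k.+1 * B k.+1 else 0)
   + (if (k < i)%N then A k * B' i k else 0))).
{ apply: eq_big_nat => i /= _; rewrite cupE; apply: eq_big_nat => k /= kd.
  rewrite !segment_face ?leqnn ?andbT ?leq0n // subn0.
  case: leqP => ik; rewrite ?addr0 ?add0r; congr (a _ * b _); apply: cell_ext.
  all: rewrite ?subSS ?subn0 ?subSn // => l lk.
  - by rewrite /bump (leq_trans ik (leq_addr _ _)).
  - by rewrite /bump add0n leqNgt (leq_ltn_trans lk ik). }
rewrite exchange_big /= -big_split /=; apply: eq_big_nat => k /= kd.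
rewrite big_split /=; congr (_ + _).
  rewrite big_distrl /= [RHS](big_nat_widen _ _ d.+2) 1?ltnW // [RHS]big_mkcond.
  by apply: eq_bigr.
rewrite big_distrr /= [RHS](big_nat_widenl _ 0) // [RHS]big_mkcond.
by apply: eq_bigr.
Qed.

(* A cochain here has a component in every degree; asking for finitely many
   nonzero ones in a cocycle makes the cohomology a direct sum over degrees. *)
Definition bounded (a : cochain) : Prop :=
  exists N, forall s : simplices, (N <= tag s)%N -> a s = 0.

Definition is_cocycle : {pred cochain} := fun a =>
  `[< bounded a /\ cobound a = 0 >].

Lemma is_cocycle_subring : subring_closed is_cocycle.
Proof.
have cb0 : cobound 0 = 0.
  by apply: (addrI (cobound 0)); rewrite -coboundD !addr0.
split=> [|a b|a b].
- apply/asboolP; split; first by exists 1%N => -[[|n] s].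
  apply/funext => -[[|d] s] //.
  rewrite -[LHS]/(\sum_(i < d.+2) cochain1 (face s i)).
  case: d s => [|d] s; last by rewrite big1.
  by rewrite !big_ord_recl big_ord0 addr0; apply: F2_addrr.
- move=> /asboolP[[N aN] da] /asboolP[[M bM] db]; apply/asboolP; split.
    exists (maxn N M) => s; rewrite geq_max => /andP[sN sM].
    by rewrite -[LHS]/(a s - b s) aN // bM // subr0.
  by rewrite coboundD coboundN da db subr0.
- move=> /asboolP[[N aN] da] /asboolP[[M bM] db]; apply/asboolP; split.
    exists (N + M)%N => -[d s] /= NMd; apply: big1 => i _ /=.
    have [Ni|iN] := leqP N i; first by rewrite aN /= ?subn0 // mul0r.
    rewrite bM ?mulr0 //= -(addKn i M) leq_sub2r // (leq_trans _ NMd) //.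
    by rewrite leq_add2r ltnW.
  rewrite [X in cobound X](_ : _ = cup a b) // cobound_cup da db.
  by rewrite [LHS](_ : _ = (0 : cochain) * b + a * (0 : cochain)) // mul0r mulr0 addr0.
Qed.

HB.instance Definition _ :=
  GRing.isSubringClosed.Build cochain is_cocycle is_cocycle_subring.

Record cocycle := Cocycle { cocycle_val :> cochain; _ : is_cocycle cocycle_val }.
HB.instance Definition _ := [isSub for cocycle_val].
HB.instance Definition _ := [Choice of cocycle by <:].
HB.instance Definition _ := GRing.SubChoice_isSubPzRing.Build
  cochain is_cocycle cocycle is_cocycle_subring.

Definition is_coboundary : {pred cocycle} := fun a =>
  `[< exists c : cochain, cocycle_val a = cobound c >].

Lemma is_coboundary_zmod : zmod_closed is_coboundary.
Proof.
split; first by apply/asboolP; exists 0; apply/esym;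
  apply: (addrI (cobound 0)); rewrite -coboundD !addr0.
move=> a b /asboolP[c ac] /asboolP[e be]; apply/asboolP; exists (c - e).
by rewrite coboundD coboundN -ac -be.
Qed.

HB.instance Definition _ :=
  GRing.isZmodClosed.Build cocycle is_coboundary is_coboundary_zmod.

Lemma cobound_cocycle (a : cocycle) : cobound a = 0.
Proof. by case: a => a /= /asboolP[]. Qed.

Lemma is_coboundaryMl (a b : cocycle) :
  b \in is_coboundary -> a * b \in is_coboundary.
Proof.
move=> /asboolP[c bc]; apply/asboolP; exists (cup a c).
by rewrite cobound_cup cobound_cocycle -bc -[cup 0 c]/((0 : cochain) * c) mul0r add0r.
Qed.

Lemma is_coboundaryMr (a b : cocycle) :
  a \in is_coboundary -> a * b \in is_coboundary.
Proof.
move=> /asboolP[c ac]; apply/asboolP; exists (cup c b).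
by rewrite cobound_cup cobound_cocycle -ac -[cup c 0]/(c * (0 : cochain)) mulr0 addr0.
Qed.

(* The singular cohomology ring of X (with the cup product) with coefficients in 'F_2. *)
Definition cohomology := @Quotient.quot cocycle is_coboundary.

HB.instance Definition _ := GRing.Zmodule.on cohomology.
HB.instance Definition _ := EqQuotient.on cohomology.

Definition cohom_class (a : cocycle) : cohomology := \pi_cohomology a.

Lemma cohom_classP a b : cohom_class a = cohom_class b <-> a - b \in is_coboundary.
Proof. by rewrite Quotient.idealrBE; split=> [/eqP|/eqP]. Qed.

Lemma cohom_class_repr (q : cohomology) : cohom_class (repr q) = q.
Proof. exact: reprK. Qed.

Lemma cohom_classD : {morph cohom_class : a b / a + b}.
Proof. by move=> a b; rewrite /cohom_class !piE. Qed.

Definition cohom_mul (x y : cohomology) := cohom_class (repr x * repr y).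

Lemma cohom_classM a b :
  cohom_class (a * b) = cohom_mul (cohom_class a) (cohom_class b).
Proof.
apply/cohom_classP; set a' := repr _; set b' := repr _.
have -> : a * b - a' * b' = a * (b - b') + (a - a') * b'.
  by rewrite mulrBr mulrBl addrA subrK.
by apply: rpredD; [apply: is_coboundaryMl | apply: is_coboundaryMr];
  apply/cohom_classP; rewrite cohom_class_repr.
Qed.

Lemma cohom_mulA : associative cohom_mul.
Proof.
move=> x y z; rewrite -[x]cohom_class_repr -[y]cohom_class_repr.
by rewrite -[z]cohom_class_repr -!cohom_classM mulrA.
Qed.

Lemma cohom_mul1x : left_id (cohom_class 1) cohom_mul.
Proof. by move=> x; rewrite -[x]cohom_class_repr -cohom_classM mul1r. Qed.

Lemma cohom_mulx1 : right_id (cohom_class 1) cohom_mul.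
Proof. by move=> x; rewrite -[x]cohom_class_repr -cohom_classM mulr1. Qed.

Lemma cohom_mulDl : left_distributive cohom_mul +%R.
Proof.
move=> x y z; rewrite -[x]cohom_class_repr -[y]cohom_class_repr.
by rewrite -[z]cohom_class_repr -cohom_classD -!cohom_classM -cohom_classD mulrDl.
Qed.

Lemma cohom_mulDr : right_distributive cohom_mul +%R.
Proof.
move=> x y z; rewrite -[x]cohom_class_repr -[y]cohom_class_repr.
by rewrite -[z]cohom_class_repr -cohom_classD -!cohom_classM -cohom_classD mulrDr.
Qed.

HB.instance Definition _ := GRing.Zmodule_isPzRing.Build cohomology
  cohom_mulA cohom_mul1x cohom_mulx1 cohom_mulDl cohom_mulDr.

Definition has_degree (d : nat) (x : cohomology) : Prop :=
  exists2 a : cocycle, (forall s : simplices, tag s != d -> cocycle_val a s = 0)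
    & x = cohom_class a.

End SingularCohomology.

Section SmallCover.
Variables (R : realType) (m : nat) (nn : 'I_m -> nat).

(* A point of the product of the simplices of dimensions nn j is given by the
   barycentric coordinates of its components; facet_of j k indexes the k-th
   coordinate of the j-th one, as well as the facet F_k^j where it vanishes. *)
Definition facet := {j : 'I_m & 'I_(nn j).+1}.
Definition facet_of (j : 'I_m) (k : 'I_(nn j).+1) : facet :=
  Tagged (fun j => 'I_(nn j).+1) k.
Arguments facet_of : clear implicits.

Definition polytope : set {ptws facet -> R} :=
  [set p | forall j, std_simplex (fun k => p (facet_of j k) : R)].

Definition facet_set (f : facet) : set {ptws facet -> R} :=
  polytope `&` [set p | p f = 0].

Definition Z2n := 'rV['F_2]_(\sum_(j < m) nn j).

Variable lam : facet -> Z2n.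

(* Over a field, every subspace is a direct summand. *)
Definition characteristic : Prop :=
  forall S : {set facet},
    \bigcap_(f in [set` S]) facet_set f !=set0 ->
    \dim <<[seq lam f | f in S]>> = #|S|.

(* tagnat.Rank j k is the position nn 0 + ... + nn (j - 1) + k, counted from 0. *)
Definition normalized : Prop :=
  forall (j : 'I_m) (k : 'I_(nn j)),
    lam (facet_of j (lift ord0 k)) = delta_mx 0 (tagnat.Rank j k).

(* The subgroup G_{F(p)}: F(p) is the intersection of the facets containing p,
   and p lies on the facet f exactly when p f = 0. *)
Definition isotropy (p : {ptws facet -> R}) : {vspace Z2n} :=
  <<[seq lam f | f in [pred f : facet | (p f == 0)%R]]>>%VS.

Definition cover_total : topologicalType :=
  (set_type polytope * discrete_topology Z2n)%type.

Definition cover_rel (x y : cover_total) : bool :=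
  (x.1 == y.1) && ((y.2 : Z2n) - x.2 \in isotropy (set_val x.1)).

Lemma cover_rel_equiv : equiv_class_of cover_rel.
Proof.
split=> [[p g]|[p g] [q h]|[q h] [p g] [r k]]; rewrite /cover_rel /=.
- by rewrite eqxx subrr mem0v.
- by rewrite eq_sym; case: eqP => //= ->; rewrite -opprB memvN.
- move=> /andP[/eqP<- gh] /andP[/eqP<- hk]; rewrite eqxx /=.
  by rewrite -(subrKA h) memvD.
Qed.
Canonical cover_equiv := EquivRelPack cover_rel_equiv.

Definition small_cover : topologicalType :=
  quotient_topology {eq_quot cover_rel}.

Definition alpha (j l : 'I_m) (k : 'I_(nn j)) : 'F_2 :=
  lam (facet_of l ord0) 0 (tagnat.Rank j k).
Arguments alpha : clear implicits.

Definition y_ (j : 'I_m) : mpoly m 'F_2 := mpolyX 'F_2 (mnm1 j).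

Definition relator (j : 'I_m) : mpoly m 'F_2 :=
  (\prod_(k < nn j) \sum_(l < m) alpha j l k *: y_ l) * y_ j.

(* The ideal generated by the relators. *)
Definition presentation_ideal (p : mpoly m 'F_2) : Prop :=
  exists c : 'I_m -> mpoly m 'F_2, p = \sum_(j < m) c j * relator j.

(* phi induces an isomorphism of graded rings from the quotient of the polynomial
   ring by the ideal above (with every y_ j in degree 1) onto the cohomology ring
   of the small cover. *)
Definition presents (phi : {rmorphism mpoly m 'F_2 -> cohomology R small_cover})
    : Prop :=
  [/\ forall h, exists p, phi p = h,
      forall p, phi p = 0 <-> presentation_ideal p
    & forall j, has_degree 1 (phi (y_ j))].

End SmallCover.

(* Main.v *)
(* Setting y_l = 0 for every l other than j sends each relator other than the
   j-th to 0, since it contains the factor y_l, and the j-th one to a multiple of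
   X ^ (n_j + 1), whereas y_j ^ n_j goes to X ^ n_j. *)
Require Import Defs.
From HB Require Import structures.
From mathcomp Require Import all_boot all_order all_algebra.
From mathcomp Require Import all_classical all_reals topology normedtype.
From mathcomp Require Import -(notations) mpoly.

Set Implicit Arguments.
Unset Strict Implicit.
Unset Printing Implicit Defensive.

Import Order.TTheory GRing.Theory Num.Theory.
Import numFieldNormedType.Exports.
Local Open Scope ring_scope.

Lemma presentation_ideal_restrict (m : nat) (nn : 'I_m -> nat)
    (lam : facet nn -> Z2n nn) (j : 'I_m) (p : mpoly m 'F_2) :
  presentation_ideal lam p ->
  exists q : {poly 'F_2},
    mmap polyC (fun l => if l == j then 'X else 0) p = q * 'X^((nn j).+1).
Proof.
move=> [c ->]; set f := fun l : 'I_m => _.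
have mmap_y l : mmap polyC f (y_ l) = f l by rewrite mmapX mmap1U.
have fj : f j = 'X by rewrite /f eqxx.
have f0 l : l != j -> f l = 0 by rewrite /f => /negPf ->.
(* Under [f] the [k]-th linear factor of the [j]-th relator becomes [alpha lam j k] times ['X];
   these constants are collected in [q], which may be zero. *)
exists (mmap polyC f (c j) * \prod_(k < nn j) (alpha lam j k)%:P).
rewrite rmorph_sum (bigD1 j) //= big1 ?addr0 => [|i ij]; last first.
  by rewrite !rmorphM /= mmap_y f0 ?mulr0.
rewrite !rmorphM /= mmap_y fj -mulrA; congr (_ * _).
rewrite exprSr mulrA; congr (_ * _).
(* The power ['X^(nn j)] is spread out as one ['X] per index [k], to compare factor by factor. *)
rewrite rmorph_prod /= -[X in 'X^X]card_ord -prodr_const -big_split /=.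
apply: eq_bigr => k _; rewrite raddf_sum (bigD1 j) //= big1 ?addr0.
  by rewrite mmapZ mmap_y fj.
by move=> l lj; rewrite mmapZ mmap_y f0 ?mulr0.
Qed.

Theorem lemma2p6 (R : realType) (m : nat) (nn : 'I_m -> nat)
    (lam : facet nn -> Z2n nn)
    (lam_char : characteristic R lam) (lam_norm : normalized lam) (j : 'I_m) :
  ~ presentation_ideal lam (y_ j ^+ nn j) /\
  forall phi : {rmorphism mpoly m 'F_2 -> cohomology R (small_cover R lam)},
    presents phi -> phi (y_ j) ^+ nn j <> 0.
Proof.
have yj_ideal : ~ presentation_ideal lam (y_ j ^+ nn j).
  move=> /(@presentation_ideal_restrict _ _ _ j)[q].
  rewrite rmorphXn /= mmapX mmap1U eqxx.
  (* In degree [nn j] the left side has coefficient 1, a multiple of ['X^((nn j).+1)] has 0. *)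
  move=> /(congr1 (fun r : {poly 'F_2} => r`_(nn j))).
  by rewrite coefXn eqxx coefMXn ltnSn => /eqP; rewrite oner_eq0.
(* The kernel of [phi] is exactly the ideal, so non-membership carries over to cohomology. *)
by split=> // phi [_ phi0 _]; rewrite -rmorphXn => /phi0.
Qed.
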